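(* Let $(X,r)$ be a finite left non-degenerate solution of the Yang--Baxter equation. If $\eta_A$ denotes the cancellative congruence of $A=A(X,r)$ and $M=M(X,r)=\{(a,\lambda_a):a\in A\}$, then $$\eta_M=\{(x,y)\in M\times M:x\circ z=y\circ z\text{ for some }z\in M\}=\{((a,\lambda_a),(b,\lambda_b))\in M\times M:(a,b)\in\eta_A\text{ and }\lambda_a=\lambda_b\}$$ (in particular these two sets coincide) is the cancellative congruence of $M$.
   Context: A (set-theoretic) solution of the Yang--Baxter equation is a pair $(X,r)$, where $X$ is a set and $r\colon X\times X\to X\times X$ satisfies $(r\times\mathrm{id})(\mathrm{id}\times r)(r\times\mathrm{id})=(\mathrm{id}\times r)(r\times\mathrm{id})(\mathrm{id}\times r)$ on $X^3$. Write $r(x,y)=(\lambda_x(y),\rho_y(x))$. It is finite if $X$ is finite and left non-degenerate if every $\lambda_x$ is bijective. The structure monoid is $M=M(X,r)=\langle X\mid x\circ y=\lambda_x(y)\circ\rho_y(x),\ x,y\in X\rangle$. Let $\sigma_y(x)=\lambda_y(\rho_{\lambda_x^{-1}(y)}(x))$ for $x,y\in X$. The left derived structure monoid, written additively, is $A=A(X,r)=\langle X\mid x+y=y+\sigma_y(x),\ x,y\in X\rangle$. Each $\lambda_x$ extends to an automorphism of $(A,+)$, and $x\mapsto\lambda_x$ extends to a monoid homomorphism $\lambda\colon M\to\mathrm{Aut}(A,+)$. There is a bijection $\pi\colon M\to A$ with $\pi(1)=0$, $\pi(x)=x$ for $x\in X$ and $\pi(m\circ m')=\pi(m)+\lambda_m(\pi(m'))$.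 For $a\in A$ put $\lambda_a=\lambda_{\pi^{-1}(a)}$. Identify $m\in M$ with $(\pi(m),\lambda_m)$, so that $M=\{(a,\lambda_a):a\in A\}$ with $(a,\lambda_a)\circ(b,\lambda_b)=(a+\lambda_a(b),\lambda_a\lambda_b)$. The cancellative congruence of a semigroup $S$ is the smallest (with respect to inclusion) congruence $\eta$ on $S$ such that $S/\eta$ is a (left and right) cancellative semigroup. *)

(* Defs.v *)
From HB Require Import structures.
From mathcomp Require Import all_boot.
From mathcomp Require Import boolp.

Set Implicit Arguments.
Unset Strict Implicit.
Unset Printing Implicit Defensive.

Import Algebra.

Local Open Scope group_scope.
Local Open Scope quotient_scope.

Section PresentedMonoid.
Variables (X : choiceType) (R : seq X -> seq X -> Prop).

Inductive pres_cong : seq X -> seq X -> Prop :=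
| pres_cong_rel u v of R u v : pres_cong u v
| pres_cong_refl u : pres_cong u u
| pres_cong_sym u v of pres_cong u v : pres_cong v u
| pres_cong_trans u v w of pres_cong u v & pres_cong v w : pres_cong u w
| pres_cong_cat u u' v v' of pres_cong u u' & pres_cong v v' :
    pres_cong (u ++ v) (u' ++ v').

Definition pres_congb : rel (seq X) := fun u v => `[< pres_cong u v >].

Lemma pres_congb_refl : reflexive pres_congb.
Proof. by move=> u; apply/asboolP/pres_cong_refl. Qed.

Lemma pres_congb_sym : symmetric pres_congb.
Proof. by move=> u v; apply/asboolP/asboolP; apply: pres_cong_sym. Qed.

Lemma pres_congb_trans : transitive pres_congb.
Proof.
move=> v u w /asboolP uv /asboolP vw.
by apply/asboolP; apply: pres_cong_trans vw.
Qed.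

Canonical pres_equiv :=
  EquivRel pres_congb pres_congb_refl pres_congb_sym pres_congb_trans.

(* the monoid presented by the generators X and the relations u = v, R u v *)
Definition pres_monoid : Type := {eq_quot pres_equiv}.

HB.instance Definition _ := Choice.on pres_monoid.
HB.instance Definition _ := EqQuotient.on pres_monoid.

Definition pres_class (u : seq X) : pres_monoid := \pi_pres_monoid u.
Definition pres_gen (x : X) : pres_monoid := pres_class [:: x].
Definition pres_one : pres_monoid := pres_class [::].
Definition pres_mul (a b : pres_monoid) : pres_monoid :=
  pres_class (repr a ++ repr b).

Lemma pres_classP u v : pres_class u = pres_class v <-> pres_cong u v.
Proof. by split=> [/eqquotP/asboolP|uv] //; apply/eqquotP/asboolP. Qed.

Lemma pres_reprK a : pres_class (repr a) = a.
Proof. exact: reprK. Qed.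

Lemma pres_repr_class u : pres_cong (repr (pres_class u)) u.
Proof. by apply/pres_classP; rewrite pres_reprK. Qed.

Lemma pres_mulE u v : pres_mul (pres_class u) (pres_class v) = pres_class (u ++ v).
Proof. by apply/pres_classP/pres_cong_cat; apply: pres_repr_class. Qed.

Lemma pres_mulA : associative pres_mul.
Proof.
move=> a b c; rewrite -(pres_reprK a) -(pres_reprK b) -(pres_reprK c).
by rewrite !pres_mulE catA.
Qed.

Lemma pres_mul1 : left_id pres_one pres_mul.
Proof. by move=> a; rewrite -(pres_reprK a) pres_mulE. Qed.

Lemma pres_mulr1 : right_id pres_one pres_mul.
Proof. by move=> a; rewrite -(pres_reprK a) pres_mulE cats0. Qed.

HB.instance Definition _ :=
  isMonoid.Build pres_monoid pres_mulA pres_mul1 pres_mulr1.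

Lemma pres_classM u v : pres_class (u ++ v) = pres_class u * pres_class v.
Proof. by rewrite -pres_mulE. Qed.

Lemma pres_class0 : pres_class [::] = 1.
Proof. by []. Qed.

End PresentedMonoid.

Section CancellativeCongruence.
Variable S : semigroupType.
Implicit Type e : S -> S -> Prop.

Definition congruence e : Prop :=
  [/\ forall x, e x x,
      forall x y, e x y -> e y x,
      forall x y z, e x y -> e y z -> e x z &
      forall x x' y y', e x x' -> e y y' -> e (x * y) (x' * y')].

(* S / e is left and right cancellative *)
Definition cancellative_quotient e : Prop :=
  (forall x y z, e (z * x) (z * y) -> e x y) /\
  (forall x y z, e (x * z) (y * z) -> e x y).

Definition is_cancellative_congruence e : Prop :=
  [/\ congruence e, cancellative_quotient e &
      forall e', congruence e' -> cancellative_quotient e' ->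
        forall x y, e x y -> e' x y].

Lemma cancellative_congruence_exists : exists e, is_cancellative_congruence e.
Proof.
exists (fun x y => forall e, congruence e -> cancellative_quotient e -> e x y).
split; last by move=> e ce qe x y; apply.
  split=> [x e [] //|x y xy e ce qe|x y z xy yz e ce qe|x x' y y' xx yy e ce qe].
  - by case: (ce) => _ + _ _; apply; apply: xy.
  - by case: (ce) => _ _ + _; apply; [apply: xy|apply: yz].
  - by case: (ce) => _ _ _; apply; [apply: xx|apply: yy].
split=> x y z h e ce qe; case: (qe) => ql qr.
- by apply: (ql _ _ z); apply: h.
- by apply: (qr _ _ z); apply: h.
Qed.

End CancellativeCongruence.

Section Solution.
Variables (X : finType) (r : X * X -> X * X).

Definition lam (x y : X) : X := (r (x, y)).1.
Definition rho (y x : X) : X := (r (x, y)).2.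

Definition r_id (t : X * X * X) : X * X * X :=
  let: (x, y, z) := t in let: (x', y') := r (x, y) in (x', y', z).
Definition id_r (t : X * X * X) : X * X * X :=
  let: (x, y, z) := t in let: (y', z') := r (y, z) in (x, y', z').

Definition yang_baxter : Prop :=
  r_id \o id_r \o r_id =1 id_r \o r_id \o id_r.

Definition left_nondegenerate : Prop := forall x, bijective (lam x).

(* finv f is the inverse of f as soon as f is bijective *)
Definition sigma (y x : X) : X := lam y (rho (finv (lam x) y) x).

Definition structure_rel (u v : seq X) : Prop :=
  exists x y, u = [:: x; y] /\ v = [:: lam x y; rho y x].

Definition derived_rel (u v : seq X) : Prop :=
  exists x y, u = [:: x; y] /\ v = [:: y; sigma y x].

Definition structure_monoid : Type := pres_monoid structure_rel.
HB.instance Definition _ := Monoid.on structure_monoid.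

(* The operation + of A(X,r) is written multiplicatively, since additive
   monoids of the library are commutative. *)
Definition derived_monoid : Type := pres_monoid derived_rel.
HB.instance Definition _ := Monoid.on derived_monoid.

Local Notation M := structure_monoid.
Local Notation A := derived_monoid.

Definition genM (x : X) : M := pres_gen structure_rel x.
Definition genA (x : X) : A := pres_gen derived_rel x.

Definition lam_word (u : seq X) : X -> X :=
  foldr (fun x f => lam x \o f) id u.

(* lamM m : A -> A is the map written lambda_m; it is evaluated on
   representatives, see lamM_class for the independence of the choice. *)
Definition lamM (m : M) (a : A) : A :=
  pres_class derived_rel (map (lam_word (repr m)) (repr a)).

(* x1 o ... o xn is sent to x1 + lam x1 x2 + ... + lam x1 (lam x2 (... xn)) *)
Fixpoint pi_word (u : seq X) : seq X :=
  if u is x :: u' then x :: map (lam x) (pi_word u') else [::].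

Definition piM (m : M) : A := pres_class derived_rel (pi_word (repr m)).

Section Facts.
Hypotheses (ybe : yang_baxter) (lnd : left_nondegenerate).

Local Notation congM := (pres_cong structure_rel).
Local Notation congA := (pres_cong derived_rel).

Lemma lamK x : cancel (lam x) (finv (lam x)).
Proof. exact/finv_f/bij_inj. Qed.

Lemma lamVK x : cancel (finv (lam x)) (lam x).
Proof. exact/f_finv/bij_inj. Qed.

Lemma ybe_components x y z :
  lam x (lam y z) = lam (lam x y) (lam (rho y x) z) /\
  rho (lam (rho y x) z) (lam x y) = lam (rho (lam y z) x) (rho z y).
Proof.
have := ybe (x, y, z); rewrite /= /lam /rho.
case: (r (x, y)) => a b /=; case: (r (b, z)) => c d /=.
case: (r (y, z)) => e f /=; case: (r (x, e)) => g h /=.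
by case: (r (a, c)) => i j /=; case: (r (h, f)) => k l /= [-> -> _].
Qed.

Lemma lam_sigma x y z : lam x (sigma z y) = sigma (lam x z) (lam x y).
Proof.
rewrite -(lamVK y z); set w := finv _ z.
have [e1 _] := ybe_components x y w.
have [_ e2] := ybe_components x y w.
rewrite /sigma lamK (ybe_components x (lam y w) _).1 -e2.
by rewrite [X in finv _ X]e1 lamK.
Qed.

Lemma congA_map f u v : (forall x z, f (sigma z x) = sigma (f z) (f x)) ->
  congA u v -> congA (map f u) (map f v).
Proof.
move=> fs; elim=> {u v} [u v [x [y [-> ->]]]|u|u v _ ih|u v w _ uv _ vw|u u' v v' _ uu _ vv].
- by apply: pres_cong_rel; exists (f x), (f y); rewrite /= fs.
- exact: pres_cong_refl.
- exact: pres_cong_sym.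
- exact: pres_cong_trans vw.
- by rewrite !map_cat; apply: pres_cong_cat.
Qed.

Lemma lam_word_sigma u x z :
  lam_word u (sigma z x) = sigma (lam_word u z) (lam_word u x).
Proof. by elim: u => //= y u ->; rewrite lam_sigma. Qed.

Lemma lam_word_cat u v : lam_word (u ++ v) =1 lam_word u \o lam_word v.
Proof. by move=> x; elim: u => //= y u ->. Qed.

Lemma lam_word_bij u : bijective (lam_word u).
Proof.
by elim: u => [|x u ih] /=; [exists id|apply: bij_comp => //; apply: lnd].
Qed.

Lemma lam_word_cong u v : congM u v -> lam_word u =1 lam_word v.
Proof.
elim=> {u v} [u v [x [y [-> ->]]]|u|u v _ ih|u v w _ uv _ vw|u u' v v' _ uu _ vv] z //.
- exact: (ybe_components x y z).1.
- by rewrite uv vw.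
- by rewrite !lam_word_cat /= vv uu.
Qed.

Lemma lamM_class u v :
  lamM (pres_class structure_rel u) (pres_class derived_rel v) =
  pres_class derived_rel (map (lam_word u) v).
Proof.
apply/pres_classP; rewrite (eq_map (lam_word_cong (pres_repr_class _ u))).
by apply: congA_map; [apply: lam_word_sigma|apply: pres_repr_class].
Qed.

Lemma lamM_gen x y : lamM (genM x) (genA y) = genA (lam x y).
Proof. exact: lamM_class. Qed.

Lemma lamM_morphism m : monoid_morphism (lamM m).
Proof.
rewrite -(pres_reprK m); split=> [|a b]; first exact: lamM_class.
rewrite -(pres_reprK a) -(pres_reprK b) -pres_classM !lamM_class.
by rewrite map_cat pres_classM.
Qed.

Lemma lamM_bij m : bijective (lamM m).
Proof.
rewrite -(pres_reprK m); set u := repr m.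
have [g fK gK] := lam_word_bij u.
have gs x z : g (sigma z x) = sigma (g z) (g x).
  by apply: (can_inj fK); rewrite lam_word_sigma !gK.
have gE v : congA (map g (repr (pres_class derived_rel v))) (map g v).
  by apply: congA_map => //; apply: pres_repr_class.
exists (fun a => pres_class derived_rel (map g (repr a))) => a.
- rewrite -(pres_reprK a) lamM_class; apply/pres_classP.
  by apply: pres_cong_trans (gE _) _; rewrite mapK //; apply: pres_cong_refl.
- rewrite -{2}(pres_reprK a) lamM_class -map_comp.
  by rewrite (eq_map (g := id)) ?map_id.
Qed.

Lemma lamM1 : lamM 1 =1 id.
Proof. by move=> a; rewrite -(pres_reprK a) lamM_class map_id. Qed.

Lemma lamMM m m' : lamM (m * m') =1 lamM m \o lamM m'.
Proof.
move=> a; rewrite -(pres_reprK m) -(pres_reprK m') -(pres_reprK a) /=.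
rewrite -pres_classM !lamM_class -map_comp; congr pres_class.
exact/eq_map/lam_word_cat.
Qed.

Lemma pi_word_cat u v :
  pi_word (u ++ v) = pi_word u ++ map (lam_word u) (pi_word v).
Proof.
elim: u => [|x u ih] /=; first by rewrite map_id.
by rewrite ih map_cat -map_comp.
Qed.

Lemma pi_word_cong u v : congM u v -> congA (pi_word u) (pi_word v).
Proof.
elim=> {u v} [u v [x [y [-> ->]]]|u|u v _ ih|u v w _ uv _ vw|u u' v v' uu ihu vv ihv] /=.
- apply: pres_cong_rel; exists x, (lam x y); split=> //.
  by rewrite /sigma lamK.
- exact: pres_cong_refl.
- exact: pres_cong_sym.
- exact: pres_cong_trans vw.
- rewrite !pi_word_cat -(eq_map (lam_word_cong uu)); apply: pres_cong_cat => //.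
  by apply: congA_map => //; apply: lam_word_sigma.
Qed.

Lemma piM_class u :
  piM (pres_class structure_rel u) = pres_class derived_rel (pi_word u).
Proof. exact/pres_classP/pi_word_cong/pres_repr_class. Qed.

Lemma piM1 : piM 1 = 1.
Proof. exact: piM_class. Qed.

Lemma piM_gen x : piM (genM x) = genA x.
Proof. exact: piM_class. Qed.

Lemma piMM m m' : piM (m * m') = piM m * lamM m (piM m').
Proof.
rewrite -(pres_reprK m) -(pres_reprK m') -pres_classM !piM_class lamM_class.
by rewrite pi_word_cat pres_classM.
Qed.

(* inverse of pi_word when f = id *)
Fixpoint unpi_word (f : X -> X) (u : seq X) : seq X :=
  if u is y :: u' then f y :: unpi_word (finv (lam (f y)) \o f) u' else [::].

Fixpoint unpi_fun (f : X -> X) (u : seq X) : X -> X :=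
  if u is y :: u' then unpi_fun (finv (lam (f y)) \o f) u' else f.

Lemma unpi_word_cat f u v :
  unpi_word f (u ++ v) = unpi_word f u ++ unpi_word (unpi_fun f u) v.
Proof. by elim: u f => //= y u ih f; rewrite ih. Qed.

Lemma unpi_fun_cat f u v : unpi_fun f (u ++ v) = unpi_fun (unpi_fun f u) v.
Proof. by elim: u f => //= y u ih f; rewrite ih. Qed.

Let sigma_morph f := forall x z, f (sigma z x) = sigma (f z) (f x).

Lemma unpi_fun_sigma f u : sigma_morph f -> sigma_morph (unpi_fun f u).
Proof.
elim: u f => //= y u ih f fs; apply: ih => x z /=.
by apply: (can_inj (lamK (f y))); rewrite lam_sigma !lamVK fs.
Qed.

Lemma unpi_cong u v : congA u v -> forall f, sigma_morph f ->
  congM (unpi_word f u) (unpi_word f v) /\ unpi_fun f u = unpi_fun f v.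
Proof.
elim=> {u v} [u v [x [y [-> ->]]]|u|u v _ ih|u v w _ uv _ vw|u u' v v' _ uu _ vv] f fs /=.
- rewrite fs -(lamVK (f x) (f y)); set t := finv _ (f y).
  rewrite /sigma lamK lamK; split.
    by apply: pres_cong_rel; exists (f x), t.
  apply/funext => z /=; set w := f z.
  apply: (can_inj (lamK (rho t (f x)))); rewrite lamVK.
  apply: (can_inj (lamK (lam (f x) t))); rewrite lamVK.
  by rewrite -(ybe_components _ _ _).1 !lamVK.
- by split=> //; apply: pres_cong_refl.
- by have [h ->] := ih f fs; split=> //; apply: pres_cong_sym.
- have [h ->] := uv f fs; have [h' ->] := vw f fs; split=> //.
  exact: pres_cong_trans h'.
- have [h e] := uu f fs; rewrite !unpi_word_cat !unpi_fun_cat -e.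
  have [h' ->] := vv _ (unpi_fun_sigma u fs).
  by split=> //; apply: pres_cong_cat.
Qed.

Lemma pi_wordK f g u : cancel g f -> unpi_word f (map g (pi_word u)) = u.
Proof.
elim: u f g => //= x u ih f g gK; rewrite gK; congr cons.
by rewrite -map_comp; apply: ih => y /=; rewrite gK lamK.
Qed.

Lemma unpi_wordK f u : pi_word (unpi_word f u) = map f u.
Proof.
elim: u f => //= y u ih f; rewrite ih -map_comp; congr cons.
by apply: eq_map => x /=; rewrite lamVK.
Qed.

Lemma piM_bij : bijective piM.
Proof.
exists (fun a => pres_class structure_rel (unpi_word id (repr a))) => [m|a].
- rewrite -(pres_reprK m) piM_class; apply/pres_classP.
  have [h _] := unpi_cong (pres_repr_class derived_rel (pi_word (repr m)))
    (f := id) (fun _ _ => erefl).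
  apply: pres_cong_trans h _.
  have := @pi_wordK id id (repr m) (fun _ => erefl); rewrite map_id => ->.
  exact: pres_cong_refl.
- by rewrite piM_class unpi_wordK map_id pres_reprK.
Qed.

End Facts.
End Solution.

(* Main.v *)
(** In both monoids the relation [exists z, x z = y z] is contained in every
    right cancellative congruence, so minimality is free.  In [A] the relations
    [x + y = y + sigma_y x] provide the Ore condition making it a congruence.
    For left cancellation choose [n > 0] with [sigma_x^n] idempotent: then
    [y + n x = n x + sigma_x^n y = sigma_x^n y + n x], so [y] is equivalent to
    [sigma_x^n y] and [n x] is central modulo the relation.  Hence the relation
    is [eta_A], and the result is transported to [M] through
    [m |-> (pi m, lambda_m)], every [lambda_m] being an automorphism of [A]. *)
Require Import Defs.
From mathcomp Require Import all_boot.
Import Algebra.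
Local Open Scope group_scope.

Set Implicit Arguments.
Unset Strict Implicit.

Definition right_mul_eq (S : semigroupType) (x y : S) : Prop :=
  exists z, x * z = y * z.

Section RightMulEq.
Variable S : semigroupType.
Local Notation "x ~ y" := (@right_mul_eq S x y) (at level 70).

Lemma right_mul_eq_min (e : S -> S -> Prop) :
  congruence e -> cancellative_quotient e -> forall x y, x ~ y -> e x y.
Proof. by case=> e_refl _ _ _ [_ er] x y [z xz]; apply: (er _ _ z); rewrite xz. Qed.

Lemma right_mul_eqMr (x y z : S) : x * z ~ y * z -> x ~ y.
Proof. by case=> t e; exists (z * t); rewrite !mulgA. Qed.

Hypothesis ore : forall a c : S, exists b, a * c = c * b.

(** The Ore condition makes [c * d] a right multiple of [d] too, so it serves as a common witness in
    a chain. It also rewrites [y * c] as [c * b], which brings the witness [c] of [x ~ x'] next to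
    [x] in [x * y * c]. *)
Lemma right_mul_eq_congruence : congruence (@right_mul_eq S).
Proof.
have trans x y z : x ~ y -> y ~ z -> x ~ z.
  move=> [c xc] [d yd]; exists (c * d); have [c' cd] := ore c d.
  by rewrite mulgA xc -mulgA cd !mulgA yd.
split=> // [x|x y [z xz]|x x' y y' [c xc] [d yd]]; first by exists x.
  by exists z.
apply: (@trans _ (x' * y)); last by exists d; rewrite -!mulgA yd.
by exists c; have [b yc] := ore y c; rewrite -!mulgA yc !mulgA xc.
Qed.

End RightMulEq.

Lemma iter_idempotent (X : finType) (f : X -> X) :
  exists n, forall x, iter n.+1 f (iter n.+1 f x) = iter n.+1 f x.
Proof.
(* Pigeonhole: there is one more index than there are self-maps of [X], so two iterates agree. *)
pose g (i : 'I_(#|{ffun X -> X}|.+1)) := [ffun x => iter i f x].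
have [i [j [ltij eij]]] : exists i j : nat, (i < j)%N /\ iter i f =1 iter j f.
  have /injectivePn [i [j neij eg]] : ~~ injectiveb g.
    apply/injectiveP => /leq_card; by rewrite card_ord ltnn.
  have eij x : iter i f x = iter j f x by move/ffunP: eg => /(_ x); rewrite !ffunE.
  case: (ltngtP i j) => [lt|lt|/val_inj e]; last by rewrite e eqxx in neij.
    by exists i, j.
  by exists j, i; split=> // x; rewrite eij.
have per k m x : (i <= m)%N -> iter (k * (j - i) + m) f x = iter m f x.
  move=> /subnK <-; set t := (m - i)%N; elim: k => // k <-.
  rewrite mulSn [(j - i + _)%N]addnC -addnA (addnCA (j - i)%N) subnK ?(ltnW ltij) //.
  by rewrite !addnA iterD -eij -iterD.
(* A multiple of the period [j - i] that is at least [i], so that [2n] and [n] give the same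
   iterate; the factor [i.+1] keeps it positive even for [i = 0]. *)
pose n := (i.+1 * (j - i))%N.
have n_gt0 : (0 < n)%N by rewrite muln_gt0 subn_gt0.
exists n.-1 => x; rewrite prednK // -iterD per //.
by rewrite (leq_trans (leqnSn i)) // leq_pmulr // subn_gt0.
Qed.

Lemma pres_monoid_ind (X : choiceType) (R : seq X -> seq X -> Prop)
    (P : pres_monoid R -> Prop) :
  P 1 -> (forall x a, P a -> P (pres_gen R x * a)) -> forall a, P a.
Proof.
move=> P1 PM a; rewrite -(pres_reprK a); elim: (repr a) => // x u.
by rewrite (pres_classM R [:: x] u); apply: PM.
Qed.

Section DerivedMonoid.
Variables (X : finType) (r : X * X -> X * X).
Local Notation A := (derived_monoid r).
Local Notation "a ~ b" := (@right_mul_eq A a b) (at level 70).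

Lemma genA_swap (x y : X) :
  genA r x * genA r y = genA r y * genA r (sigma r y x).
Proof.
rewrite -[LHS]pres_classM -[RHS]pres_classM.
by apply/pres_classP/pres_cong_rel; exists x, y.
Qed.

Lemma genA_swap_iter (x y : X) n :
  genA r y * genA r x ^+ n = genA r x ^+ n * genA r (iter n (sigma r x) y).
Proof.
elim: n => [|n ih]; first by rewrite mulg1 mul1g.
by rewrite expgSr mulgA ih -mulgA genA_swap mulgA.
Qed.

Lemma derived_ore (a c : A) : exists b, a * c = c * b.
Proof.
move: c a; apply: pres_monoid_ind => [a|y c ihc a].
  by exists a; rewrite mulg1 mul1g.
(* A single generator [y] moves left through [a], each letter [x] it passes becoming
   [sigma r y x]. *)
have [b ab] : exists b, a * genA r y = genA r y * b.
  move: a; apply: pres_monoid_ind => [|x a [b ab]].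
    by exists 1; rewrite mulg1 mul1g.
  by exists (genA r (sigma r y x) * b); rewrite -mulgA ab !mulgA genA_swap.
have [b' bc] := ihc b.
by exists b'; rewrite mulgA ab -mulgA bc mulgA.
Qed.

Lemma derived_congruence : congruence (@right_mul_eq A).
Proof. exact/right_mul_eq_congruence/derived_ore. Qed.

Lemma genA_power_central (x : X) :
  exists n, forall a : A, genA r x ^+ n.+1 * a ~ a * genA r x ^+ n.+1.
Proof.
have [eR eS eT eM] := derived_congruence.
have [n idem] := iter_idempotent (sigma r x); exists n.
set c := genA r x ^+ n.+1; apply: pres_monoid_ind => [|y a ih].
  by rewrite mulg1 mul1g.
rewrite -/(genA r y); set y' := genA r (iter n.+1 (sigma r x) y).
have yc : genA r y * c = c * y' by rewrite genA_swap_iter.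
(* By idempotence, [y' * c] also equals [c * y']. *)
have yy' : genA r y ~ y' by exists c; rewrite yc genA_swap_iter idem.
have cy : c * genA r y ~ genA r y * c by rewrite yc; apply: eM.
rewrite mulgA -[_ * a * c]mulgA; apply: eT (eM _ _ _ _ cy (eR a)) _.
by rewrite -mulgA; apply: eM ih.
Qed.

Lemma derived_lcancel (z a b : A) : z * a ~ z * b -> a ~ b.
Proof.
have [eR eS eT eM] := derived_congruence.
move: z a b; apply: pres_monoid_ind => [a b|x z ih a b].
  by rewrite !mul1g.
rewrite -!mulgA -/(genA r x) => xab; apply: ih.
have [n central] := genA_power_central x; set c := _ ^+ _ in central.
apply: (@right_mul_eqMr _ _ _ c).
apply: (eT _ _ _ (eS _ _ (central _))); apply: (eT _ _ _ _ (central _)).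
by rewrite /c expgSr -!mulgA; apply: eM.
Qed.

Lemma derived_cancellative_congruence :
  is_cancellative_congruence (@right_mul_eq A).
Proof.
split; [exact: derived_congruence| |exact: right_mul_eq_min].
by split=> [a b z|a b z]; [apply: derived_lcancel|apply: right_mul_eqMr].
Qed.

End DerivedMonoid.

Section StructureMonoid.
Variables (X : finType) (r : X * X -> X * X).
Hypotheses (r_ybe : yang_baxter r) (r_lnd : left_nondegenerate r).
Local Notation M := (structure_monoid r).
Local Notation A := (derived_monoid r).

Lemma right_mul_eq_lamM (m : M) (a b : A) :
  right_mul_eq (lamM m a) (lamM m b) <-> right_mul_eq a b.
Proof.
have [_ lamD] := lamM_morphism r_ybe r_lnd m.
have [g gK Kg] := lamM_bij r_ybe r_lnd m.
split=> [[c]|[c e]]; last by exists (lamM m c); rewrite -!lamD e.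
by rewrite -(Kg c) -!lamD => /(can_inj gK) e; exists (g c).
Qed.

(** If [x * z = y * z], surjectivity of [lamM z] gives equal actions, and applying [piM] yields the
    witness [lamM x (piM z)] in [A]. Conversely, a witness [c] has this form for some [z], since
    [lamM x] and [piM] are bijective. *)
Lemma structure_right_mul_eqP (x y : M) :
  right_mul_eq x y <-> right_mul_eq (piM x) (piM y) /\ lamM x =1 lamM y.
Proof.
split=> [[z e]|[[c e] exy]].
  have exy : lamM x =1 lamM y.
    have [g _ Kg] := lamM_bij r_ybe r_lnd z => a.
    have /= := lamMM r_ybe r_lnd x z (g a).
    by rewrite e lamMM //= Kg.
  split=> //; exists (lamM x (piM z)).
  by rewrite {2}exy -!piMM // e.
have [g _ Kg] := lamM_bij r_ybe r_lnd x.
have [p pK Kp] := piM_bij r_ybe r_lnd.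
exists (p (g c)); apply: (can_inj pK).
by rewrite !piMM // Kp -exy Kg.
Qed.

Lemma structure_cancellative_congruence :
  is_cancellative_congruence (@right_mul_eq M).
Proof.
have [eR eS eT eM] := derived_congruence r.
split; last exact: right_mul_eq_min.
  split=> [x|x y [z e]|x y z|x x' y y']; first by exists x.
  - by exists z.
  - move=> /structure_right_mul_eqP[xy lxy] /structure_right_mul_eqP[yz lyz].
    apply/structure_right_mul_eqP; split; first exact: eT yz.
    by move=> a; rewrite lxy.
  - move=> /structure_right_mul_eqP[xx lxx] /structure_right_mul_eqP[yy lyy].
    apply/structure_right_mul_eqP; split=> [|a]; last first.
      by rewrite !lamMM //= lyy lxx.
    (* Equal actions put the same automorphism [lamM x] on both second factors. *)
    by rewrite !piMM // -lxx; apply: eM => //; apply/right_mul_eq_lamM.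
split=> x y z; last exact: right_mul_eqMr.
move=> /structure_right_mul_eqP[zxy lzxy]; apply/structure_right_mul_eqP; split.
  (* Since [piM (z * x) = piM z * lamM z (piM x)], cancel [piM z] in [A], then undo the automorphism
     [lamM z]. *)
  apply/(right_mul_eq_lamM z)/(@derived_lcancel _ _ (piM z)).
  by rewrite -!piMM.
move=> a; apply: (bij_inj (lamM_bij r_ybe r_lnd z)).
by have := lzxy a; rewrite !lamMM.
Qed.

End StructureMonoid.

Unset Implicit Arguments.
Set Strict Implicit.

Theorem proposition7p2 (X : finType) (r : X * X -> X * X)
    (r_ybe : yang_baxter r) (r_lnd : left_nondegenerate r)
    (etaA : derived_monoid r -> derived_monoid r -> Prop)
    (etaA_cc : is_cancellative_congruence etaA) :
  let etaM (x y : structure_monoid r) := exists z, x * z = y * z in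
  (forall x y, etaM x y <-> etaA (piM x) (piM y) /\ lamM x =1 lamM y) /\
  is_cancellative_congruence etaM.
Proof.
move=> etaM; split; last exact: structure_cancellative_congruence.
have [eC eQ eMin] := etaA_cc.
have [rC rQ _] := derived_cancellative_congruence r.
(* Both relations are least among the cancellative congruences of [A], so each contains the
   other. *)
have etaAE a b : etaA a b <-> right_mul_eq a b.
  by split; [apply: eMin|apply: right_mul_eq_min].
by move=> x y; rewrite etaAE; apply: structure_right_mul_eqP.
Qed.
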